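(* Standard power system networks can be cast into a compact matrix form using the sparse tableau matrix, with time-invariant circuit elements (implying that the matrices $F_v$, $F_i$ are constant), with each network element being a non-independent source (no network element is or contains an independent source), and with each bus having a current source (implying that the source term is the vector $I$ of externally injected currents). This sparse tableau formulation of the power system network is $$\underbrace{\begin{bmatrix} \mathbf{0} & \mathbf{0} & A \\ -A^T & \mathbf{I} & \mathbf{0} \\ \mathbf{0} & F_v & F_i \end{bmatrix}}_{T} \underbrace{\begin{bmatrix} V \\ v \\ i \end{bmatrix}}_{x} = \underbrace{\begin{bmatrix} I \\ 0 \\ 0 \end{bmatrix}}_{u},$$ where $I$ represents the externally injected current source from generators or loads.
   Context: All electrical quantities are complex phasors. The network has $N$ buses (nodes) and $l$ network elements. Standard power system network elements are represented as two-port elements and are taken to be linear and time-invariant; typical examples are transmission lines and transformers. Element $k\in\{1,\dots,l\}$ has ports $a$ (sending end) and $b$ (receiving end), with port voltages $v_{k,a},v_{k,b}\in\mathbb{C}$ and port currents $i_{k,a},i_{k,b}\in\mathbb{C}$. These are stacked as $v=(v_{1,a},v_{1,b},\dots,v_{l,a},v_{l,b})^T\in\mathbb{C}^{2l}$ and $i=(i_{1,a},i_{1,b},\dots,i_{l,a},i_{l,b})^T\in\mathbb{C}^{2l}$. $V\in\mathbb{C}^N$ is the vector of bus voltages, and $I\in\mathbb{C}^N$ is the vector of complex currents injected at the buses by generators or loads. Element equations: in general, affine linear circuit elements have constitutive equations $F_v v+F_i i=u_s$, where $u_s$ represents independent sources. The constitutive relation of a two-port element imposes two independent algebraic constraints on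 its four port variables. For a linear network element $k$ without independent sources it is written $$F_{k,v}\begin{bmatrix} v_{k,a}\\ v_{k,b}\end{bmatrix}+F_{k,i}\begin{bmatrix} i_{k,a}\\ i_{k,b}\end{bmatrix}=\begin{bmatrix}0\\0\end{bmatrix},\qquad F_{k,v},F_{k,i}\in\mathbb{C}^{2\times 2},$$ and time-invariance means that these coefficient matrices are constant with respect to time. $F_v,F_i\in\mathbb{C}^{2l\times 2l}$ are the block diagonal matrices with diagonal blocks $F_{1,v},\dots,F_{l,v}$ and $F_{1,i},\dots,F_{l,i}$ respectively. Incidence matrix: $A\in\mathbb{R}^{N\times 2l}$ is the node-to-element incidence matrix, with $A(j,r)=1$ if the $r$th component of $i$ corresponds to an element's sending or receiving terminal leaving node $j$, $A(j,r)=-1$ if the $r$th component of $i$ corresponds to an element's sending or receiving terminal entering node $j$, and $A(j,r)=0$ otherwise. The three block rows of the matrix form are, respectively, Kirchhoff's current law $I-Ai=0$ in $\mathbb{C}^N$, Kirchhoff's voltage law $v-A^TV=0$ in $\mathbb{C}^{2l}$, and the network element equations $F_vv+F_ii=0$. $\mathbf{0}$ and $\mathbf{I}$ denote a zero matrix and an identity matrix of appropriate dimension ($\mathbf{I}$ is not to be confused with the current vector $I$). *)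

(* Defs.v *)
From HB Require Import structures.
From mathcomp Require Import all_boot all_order all_algebra.
From mathcomp Require Import reals complex.
Set Implicit Arguments.
Unset Strict Implicit.
Unset Printing Implicit Defensive.
Import Order.TTheory GRing.Theory Num.Theory.
Local Open Scope ring_scope.
Local Open Scope complex_scope.

(* The two ports of an element are indexed by 'I_2: 0 is the sending end a and
   1 is the receiving end b.  Port quantities are families x k p with
   k : 'I_l the element and p : 'I_2 the port. *)

(* The number 2l of element terminals, in the form of the dimensions of
   \mxcol, \mxrow and \mxdiag. *)
Definition nports (l : nat) : nat := (\sum_(k < l) 2)%N.

Lemma nportsE l : nports l = (2 * l)%N.
Proof. by rewrite /nports sum_nat_const card_ord mulnC. Qed.

(* Affine linear two-port F_v(t) v + F_i(t) i = u_s(t), whose two scalar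
   constraints on the four port variables are independent at every time. *)
Record two_port (R : realType) (Time : Type) := TwoPort {
  coefv : Time -> 'M[R[i]]_2;
  coefi : Time -> 'M[R[i]]_2;
  source : Time -> 'cV[R[i]]_2;
  independent_constraints :
    forall t, row_free (row_mx (coefv t) (coefi t))
}.

Definition time_invariant (R : realType) (Time : Type) (e : two_port R Time) :=
  exists Fv Fi : 'M[R[i]]_2, forall t, coefv e t = Fv /\ coefi e t = Fi.

Definition source_free (R : realType) (Time : Type) (e : two_port R Time) :=
  forall t, source e t = 0.

(* Terminal p of element k is an oriented branch, from the bus leaves k p to
   the bus enters k p, along which its voltage and current are both measured;
   None stands for the voltage reference (ground), which is not a bus.  For a
   terminal connected to a single bus, one of the two is None. *)
Record network (R : realType) (Time : Type) (N l : nat) := Network {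
  element : 'I_l -> two_port R Time;
  leaves : 'I_l -> 'I_2 -> option 'I_N;
  enters : 'I_l -> 'I_2 -> option 'I_N;
  no_loop : forall k p j, leaves k p = Some j -> enters k p <> Some j
}.

Section Network.
Variables (R : realType) (Time : Type) (N l : nat) (net : network R Time N l).

(* Every bus j carries a source injecting the current I j 0. *)
Definition kirchhoff_current_law
    (I : 'cV[R[i]]_N) (cur : 'I_l -> 'I_2 -> R[i]) :=
  forall j : 'I_N,
    I j 0 = \sum_k \sum_(p | leaves net k p == Some j) cur k p
          - \sum_k \sum_(p | enters net k p == Some j) cur k p.

Definition potential (V : 'cV[R[i]]_N) (b : option 'I_N) : R[i] :=
  if b is Some j then V j 0 else 0.

Definition kirchhoff_voltage_law
    (V : 'cV[R[i]]_N) (volt : 'I_l -> 'I_2 -> R[i]) :=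
  forall k p,
    volt k p = potential V (leaves net k p) - potential V (enters net k p).

Definition element_equations (t : Time) (volt cur : 'I_l -> 'I_2 -> R[i]) :=
  forall k,
    coefv (element net k) t *m (\col_p volt k p)
      + coefi (element net k) t *m (\col_p cur k p)
    = source (element net k) t.

Definition network_equations (t : Time) (I V : 'cV[R[i]]_N)
    (volt cur : 'I_l -> 'I_2 -> R[i]) :=
  [/\ kirchhoff_current_law I cur,
      kirchhoff_voltage_law V volt &
      element_equations t volt cur].

Definition incidence : 'M[R]_(N, nports l) :=
  \mxrow_(k < l) \matrix_(j < N, p < 2)
    (if leaves net k p == Some j then 1
     else if enters net k p == Some j then -1
     else 0).

End Network.

(* (x_{1,a}, x_{1,b}, ..., x_{l,a}, x_{l,b})^T *)
Definition stack (R : realType) (l : nat) (x : 'I_l -> 'I_2 -> R[i]) :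
    'cV[R[i]]_(nports l) :=
  \mxcol_(k < l) \col_(p < 2) x k p.

Definition block_diag (R : realType) (l : nat) (F : 'I_l -> 'M[R[i]]_2) :
    'M[R[i]]_(nports l) :=
  \mxdiag_(k < l) F k.

Definition sparse_tableau (R : realType) (N n : nat)
    (A : 'M[R[i]]_(N, n)) (Fv Fi : 'M[R[i]]_n) : 'M[R[i]]_(N + (n + n)) :=
  col_mx (row_mx 0        (row_mx 0    A))
 (col_mx (row_mx (- A^T)  (row_mx 1%:M 0))
         (row_mx 0        (row_mx Fv   Fi))).

(* Main.v *)
Require Import Defs.
From HB Require Import structures.
From mathcomp Require Import all_boot all_order all_algebra.
From mathcomp Require Import reals complex.
Set Implicit Arguments.
Unset Strict Implicit.
Unset Printing Implicit Defensive.
Import Order.TTheory GRing.Theory Num.Theory.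
Local Open Scope ring_scope.

(** Blockwise multiplication of the tableau by the stacked unknowns gives [A *m i], [v - A^T *m V]
    and [Fv *m v + Fi *m i] ([sparse_tableau_mul]), so the tableau equation is three block
    equations, and each is the stacked form of one family of scalar laws. An incidence entry is the
    indicator of leaving minus that of entering; hence row [j] of [A] sums the net current leaving
    bus [j] ([incidence_mul_stack]), and each row of [A^T] takes a potential difference
    ([tr_incidence_mul]). Time-invariance supplies the constant blocks, source-freeness the zero
    right-hand side. *)

(* [no_loop] makes the two cases of [incidence] exclusive, so that each entry is
   the difference of two indicators. *)
Lemma map_incidence (R : realType) (Time : Type) (N l : nat)
    (net : network R Time N l) :
  map_mx (real_complex R) (incidence net) =
  \mxrow_(k < l) \matrix_(j < N, p < 2)
    ((leaves net k p == Some j)%:R - (enters net k p == Some j)%:R).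
Proof.
apply/matrixP => j r; rewrite !mxE.
case: (leaves net _ _ =P Some j) => [hl|_].
  by rewrite (introF eqP (no_loop hl)) subr0 rmorph1.
by case: (_ == _); rewrite ?rmorphN1 ?rmorph0 ?sub0r ?oppr0.
Qed.

Lemma sum_condM (R : nzRingType) (I : finType) (P : pred I) (F : I -> R) :
  \sum_i (P i)%:R * F i = \sum_(i | P i) F i.
Proof.
rewrite [RHS]big_mkcond; apply: eq_bigr => i _.
by case: (P i); rewrite ?mul1r ?mul0r.
Qed.

Lemma incidence_mul_stack (R : realType) (Time : Type) (N l : nat)
    (net : network R Time N l) (x : 'I_l -> 'I_2 -> R[i]) (j : 'I_N) :
  (map_mx (real_complex R) (incidence net) *m stack x) j 0 =
    \sum_k \sum_(p | leaves net k p == Some j) x k p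
  - \sum_k \sum_(p | enters net k p == Some j) x k p.
Proof.
rewrite map_incidence mul_mxrow_mxcol summxE -sumrB; apply: eq_bigr => k _.
rewrite mxE -[X in _ = X - _]sum_condM -[X in _ = _ - X]sum_condM -sumrB.
apply: eq_bigr => p _.
by rewrite !mxE mulrBl.
Qed.

(** Puts a potential in the shape of an entry of [A^T *m V]. Ground matches no bus, so all its
    indicators vanish and the sum is the reference value 0. *)
Lemma potentialE (R : realType) (N : nat) (V : 'cV[R[i]]_N) (b : option 'I_N) :
  potential V b = \sum_j (b == Some j)%:R * V j 0.
Proof.
case: b => [i|] /=; last by rewrite big1 // => j _; rewrite mul0r.
by rewrite sum_condM (big_pred1 i).
Qed.

Lemma tr_incidence_mul (R : realType) (Time : Type) (N l : nat)
    (net : network R Time N l) (V : 'cV[R[i]]_N) :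
  (map_mx (real_complex R) (incidence net))^T *m V =
  stack (fun k p =>
    potential V (leaves net k p) - potential V (enters net k p)).
Proof.
rewrite map_incidence tr_mxrow mxcol_mul; apply: eq_mxcol => k.
apply/colP => p; rewrite !mxE !potentialE -sumrB.
by apply: eq_bigr => j _; rewrite !mxE mulrBl.
Qed.

(** Passes between laws stated terminal by terminal and equations of stacked vectors. *)
Lemma stackP (R : realType) (l : nat) (x y : 'I_l -> 'I_2 -> R[i]) :
  (forall k p, x k p = y k p) <-> stack x = stack y.
Proof.
rewrite /stack -eq_mxcolP; split=> xy k.
  by apply/colP => p; rewrite !mxE xy.
by move=> p; have /colP/(_ p) := xy k; rewrite !mxE.
Qed.

Lemma sparse_tableau_mul (R : realType) (N n : nat)
    (A : 'M[R[i]]_(N, n)) (Fv Fi : 'M[R[i]]_n) (V : 'cV[R[i]]_N)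
    (v i : 'cV[R[i]]_n) :
  sparse_tableau A Fv Fi *m col_mx V (col_mx v i) =
  col_mx (A *m i) (col_mx (v - A^T *m V) (Fv *m v + Fi *m i)).
Proof.
rewrite /sparse_tableau !mul_col_mx !mul_row_col !mul0mx mul1mx mulNmx.
by rewrite !add0r addr0 addrC.
Qed.

Theorem proposition1 (R : realType) (Time : Type) (N l : nat)
    (net : network R Time N l)
    (hTI : forall k : 'I_l, time_invariant (element net k))
    (hSF : forall k : 'I_l, source_free (element net k)) :
  exists F_kv F_ki : 'I_l -> 'M[R[i]]_2,
    (forall (t : Time) (k : 'I_l),
       coefv (element net k) t = F_kv k /\ coefi (element net k) t = F_ki k) /\
    let Fv := block_diag F_kv in
    let Fi := block_diag F_ki in
    let A := map_mx (real_complex R) (incidence net) in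
    forall (t : Time) (I V : 'cV[R[i]]_N) (volt cur : 'I_l -> 'I_2 -> R[i]),
      let v := stack volt in
      let i := stack cur in
      [/\ kirchhoff_current_law net I cur <-> I - A *m i = 0,
          kirchhoff_voltage_law net V volt <-> v - A^T *m V = 0,
          element_equations net t volt cur <-> Fv *m v + Fi *m i = 0 &
          network_equations net t I V volt cur <->
            sparse_tableau A Fv Fi *m col_mx V (col_mx v i)
              = col_mx I (col_mx 0 0)].
Proof.
(* Each element has its own constant matrices; as there are finitely many elements, two finite
   choices collect them into families. *)
have [F_kv /fin_all_exists[F_ki FE]] := fin_all_exists hTI.
exists F_kv, F_ki; split=> [t k|]; first exact: FE.
move=> Fv Fi A t I V volt cur v i.
have kcl : kirchhoff_current_law net I cur <-> I - A *m i = 0.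
  split=> [KCL|/subr0_eq -> j]; last exact: incidence_mul_stack.
  apply/eqP; rewrite subr_eq0; apply/eqP/colP => j.
  by rewrite KCL incidence_mul_stack.
have kvl : kirchhoff_voltage_law net V volt <-> v - A^T *m V = 0.
  rewrite tr_incidence_mul; split=> [/stackP KVL|/subr0_eq /stackP //].
  by rewrite /v KVL subrr.
have elt : element_equations net t volt cur <-> Fv *m v + Fi *m i = 0.
  (* Block-diagonal matrices act element by element, so with 0 read as a column of zero blocks the
     equation decouples over [k]. *)
  rewrite !mul_mxdiag_mxcol -mxcolD -(mxcol0 _) -eq_mxcolP.
  by split=> EE k; have := EE k; have [-> ->] := FE k t; rewrite hSF.
(* Only the current law changes form: the tableau has [A *m i] equal to [I], where [kcl] has a
   vanishing difference. *)
split=> //; rewrite sparse_tableau_mul; split.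
  by case=> /kcl/subr0_eq <- /kvl -> /elt ->.
move=> /eq_col_mx[AI /eq_col_mx[KVL EE]].
by split; [apply/kcl; rewrite AI subrr | apply/kvl | apply/elt].
Qed.
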